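(* Let $\frac{\alpha}{\beta}>0$ be a rational number, with $\alpha,\beta$ coprime positive integers. There is a unique regular continued fraction of the form $$\frac{\alpha}{\beta}=[1,e_2,\ldots,e_n],\qquad e_i=\pm 1$$ (unique means that both the length $n$ and the signs $e_i$ are determined by $\alpha/\beta$). Furthermore, writing $e_1=1$, one has $\alpha>\beta$ if and only if $[e_1,e_2,\ldots,e_n]$ is biregular.
   Context: For integers $a_1,\dots,a_n$, $[a_1,\ldots,a_n]$ denotes the continued fraction $a_1+\cfrac{1}{a_2+\cfrac{1}{\cdots+\cfrac{1}{a_n}}}$. A continued fraction $[a_1,\ldots,a_n]$ is called regular if $a_i\neq 0$ for all $i$, $a_{n-1}a_n>0$ (when $n\ge 2$), and $a_ia_{i+1}<0\Rightarrow a_{i+1}a_{i+2}>0$ for $i=1,\ldots,n-2$ (there are no two consecutive sign changes). It is called biregular if it is regular, $n\ge 2$, and moreover $a_1a_2>0$. *)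

(* Defs.v *)
From mathcomp Require Import all_boot all_order all_algebra.

Set Implicit Arguments.
Unset Strict Implicit.
Unset Printing Implicit Defensive.

Import Order.TTheory GRing.Theory Num.Theory.
Local Open Scope ring_scope.

(* [None] stands for "undefined": the sequence is empty, or a denominator
   vanishes (in [rat], [0^-1] is [0], so this has to be excluded by hand). *)
Fixpoint cfrac (s : seq int) : option rat :=
  match s with
  | [::] => None
  | [:: a] => Some a%:~R
  | a :: s' =>
      if cfrac s' is Some x then
        if x == 0 then None else Some (a%:~R + x^-1)
      else None
  end.

(* The term a_i of the continued fraction is [s`_(i - 1)]. *)
Definition regular_cfrac (s : seq int) : Prop :=
  [/\ forall i : nat, (i < size s)%N -> s`_i <> 0,
      (1 < size s)%N -> 0 < s`_(size s - 2) * s`_(size s - 1)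
    & forall i : nat, (i.+2 < size s)%N ->
        s`_i * s`_i.+1 < 0 -> 0 < s`_i.+1 * s`_i.+2].

Definition biregular_cfrac (s : seq int) : Prop :=
  [/\ regular_cfrac s, (1 < size s)%N & 0 < s`_0 * s`_1].

(* Main.v *)
Require Import Defs.
From mathcomp Require Import all_boot all_order all_algebra.
From mathcomp Require Import zify ring.

Import Order.TTheory GRing.Theory Num.Theory.
Local Open Scope ring_scope.

(** A regular continued fraction with entries 1 and -1 that starts with 1 is
    [1], or [1, s], or [1, -1, - s], with s of the same kind: a sign change
    cannot be followed by another one, nor end the sequence.  If s has value
    y > 0, the values are 1, 1 + 1/y > 1 and 1/(1 + y) < 1, so the value
    determines both the case and y.  For alpha/beta this is the subtractive
    Euclidean algorithm, whence existence. *)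

Inductive sign_cfrac : seq int -> rat -> Prop :=
| SignCfrac1 : sign_cfrac [:: 1] 1
| SignCfracGt s y : sign_cfrac s y -> sign_cfrac (1 :: s) (1 + y^-1)
| SignCfracLt s y : sign_cfrac s y ->
    sign_cfrac [:: 1, -1 & map -%R s] (1 + y)^-1.

Lemma sign_cfrac_gt0 s x : sign_cfrac s x -> 0 < x.
Proof.
by elim=> {s x} [|s y _ y0|s y _ y0] //; rewrite ?invr_gt0 addr_gt0 ?invr_gt0.
Qed.

Lemma sign_cfrac_head s x : sign_cfrac s x -> exists t, s = 1 :: t.
Proof. by case=> [|{}s y _|{}s y _]; eexists. Qed.

Lemma cfrac_opp s : cfrac (map -%R s) = omap -%R (cfrac s).
Proof.
elim: s => [|a [|b s] IH] //=; first by rewrite rmorphN.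
rewrite /= in IH; rewrite IH.
case: (match s with [::] => _ | _ => _ end) => //= x.
by rewrite oppr_eq0; case: eqP => //= _; rewrite rmorphN opprD invrN.
Qed.

Lemma cfrac_cons a s x : cfrac s = Some x -> x != 0 ->
  cfrac (a :: s) = Some (a%:~R + x^-1).
Proof.
by case: s => [|b s] // H /negbTE x0; rewrite [LHS]/= -/(cfrac (b :: s)) H x0.
Qed.

(** Positivity of the values keeps every denominator nonzero. In the last case the tail after the
    leading 1 has value [-1 - 1/y = -(1 + y)/y], and [1 - y/(1 + y) = 1/(1 + y)]. *)
Lemma sign_cfracE s x : sign_cfrac s x -> cfrac s = Some x.
Proof.
elim=> {s x} [|s y sy IH|s y sy IH] //; have y0 := sign_cfrac_gt0 _ _ sy.
  exact: cfrac_cons IH (lt0r_neq0 y0).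
have IHN : cfrac (map -%R s) = Some (- y) by rewrite cfrac_opp IH.
have y1 : 1 + y != 0 by rewrite lt0r_neq0 ?addr_gt0.
have H1 : cfrac (-1 :: map -%R s) = Some (- ((1 + y) / y)).
  rewrite (cfrac_cons _ _ _ IHN) ?oppr_eq0 ?lt0r_neq0 //.
  by congr Some; rewrite rmorphN1; field; exact: lt0r_neq0.
have H2 : - ((1 + y) / y) != 0.
  by rewrite oppr_eq0 mulf_neq0 ?y1 // invr_eq0 lt0r_neq0.
rewrite (cfrac_cons _ _ _ H1 H2).
by congr Some; field; rewrite y1 lt0r_neq0.
Qed.

Lemma sign_cfrac_inj s t x : sign_cfrac s x -> sign_cfrac t x -> s = t.
Proof.
have gt1 y : 0 < y -> 1 < 1 + y^-1 :> rat by move=> y0; rewrite ltrDl invr_gt0.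
have lt1 y : 0 < y -> (1 + y)^-1 < 1 :> rat.
  by move=> y0; rewrite invf_lt1 ?addr_gt0 // ltrDl.
move=> sx; elim: sx t => {s x} [|s y sy IH|s y sy IH] t;
  (try have y0 := sign_cfrac_gt0 _ _ sy);
  (* Abstracting the value turns its two forms into an equation [ex]. Comparison with 1 refutes [ex]
     for distinct constructors; for equal ones it yields the same [y]. *)
  move ex: (X in sign_cfrac t X) => x tx;
  case: tx ex => [|{}t z tz|{}t z tz] ex //;
  (try have z0 := sign_cfrac_gt0 _ _ tz).
- by have := gt1 _ z0; rewrite -ex ltxx.
- by have := lt1 _ z0; rewrite -ex ltxx.
- by have := gt1 _ y0; rewrite ex ltxx.
- by move/addrI/invr_inj: ex => ex; rewrite (IH t) // ex.
- by have := gt1 _ y0; rewrite ex ltNge ltW ?lt1.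
- by have := lt1 _ y0; rewrite ex ltxx.
- by have := lt1 _ y0; rewrite ex ltNge ltW ?gt1.
- by move/invr_inj/addrI: ex => ex; rewrite (IH t) // ex.
Qed.

Lemma regular_cfrac_opp s : regular_cfrac s -> regular_cfrac (map -%R s).
Proof.
have nthN i : (map -%R s)`_i = - s`_i.
  (* Past the end both sides are the default [0]. *)
  have [lt_is|le_si] := ltnP i (size s); first exact: nth_map.
  by rewrite !nth_default ?size_map ?oppr0.
case=> nz last2 changes; split; rewrite size_map.
- by move=> i /nz/eqP si0; rewrite nthN; apply/eqP; rewrite oppr_eq0.
- by rewrite !nthN mulrNN.
- by move=> i; rewrite !nthN !mulrNN; exact: changes.
Qed.

Lemma regular_cfrac2 (a b : int) : regular_cfrac [:: a; b] <-> 0 < a * b.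
Proof.
split=> [[_ /(_ isT)]|ab] //; split=> // -[|[|i]] //= _ H;
  by rewrite H ?mul0r ?mulr0 in ab.
Qed.

(** This allows recursion on the tail: with two entries left after [a], both sequences end in the
    same pair. *)
Lemma regular_cfrac3 (a b c : int) s : regular_cfrac [:: a, b, c & s] <->
  [/\ a <> 0, a * b < 0 -> 0 < b * c & regular_cfrac [:: b, c & s]].
Proof.
have sz2 : ((size s).+3 - 2 = ((size s).+2 - 2).+1)%N by lia.
have sz1 : ((size s).+3 - 1 = ((size s).+2 - 1).+1)%N by lia.
split=> [[nz last2 changes]|[a0 abc [nz last2 changes]]].
  split; [exact: nz 0%N _ | exact: changes 0%N _ | split].
  - by move=> i; exact: nz i.+1.
  - by move=> _; move: (last2 isT); rewrite [size _]/= sz2 sz1.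
  - by move=> i; exact: changes i.+1.
split=> [[|i]|_|[|i]] //; first exact: nz.
- by move: (last2 isT); rewrite ![size _]/= sz2 sz1.
- exact: changes.
Qed.

Definition signs (s : seq int) := forall x : int, x \in s -> x = 1 \/ x = -1.

Lemma sign_cfrac_signs s x : sign_cfrac s x -> signs s.
Proof.
elim=> {s x} [|s y _ IH|s y _ IH] x; rewrite !inE.
- by move/eqP; left.
- by case/orP=> [/eqP|/IH]; [left|].
- case/or3P=> [/eqP|/eqP|/mapP[z /IH sz ->]]; [by left|by right|].
  by case: sz => ->; [right|left; rewrite opprK].
Qed.

(** Since [s] starts with 1, prepending 1 creates no sign change, and in [1, -1, - s] the change at
    the front is followed by the equal signs [-1, -1]. *)
Lemma sign_cfrac_regular s x : sign_cfrac s x -> regular_cfrac s.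
Proof.
elim=> {s x} [|s y sy IH|s y sy IH]; first by split=> // -[].
- case: sy IH => [_|{}s z sz|{}s z _]; first exact/regular_cfrac2.
    by have [t ->] := sign_cfrac_head _ _ sz; move=> IH; apply/regular_cfrac3.
  by move=> IH; apply/regular_cfrac3.
have [t est] := sign_cfrac_head _ _ sy; move: IH; rewrite est /= => IH.
apply/regular_cfrac3; split=> //.
case: t IH {est} => [|b t] IH /=; first exact/regular_cfrac2.
apply/regular_cfrac3; split=> //.
exact: regular_cfrac_opp _ IH.
Qed.

Lemma signs_opp s : signs s -> signs (map -%R s).
Proof.
move=> sgn x /mapP[y /sgn [] -> ->]; first by right.
by left; rewrite opprK.
Qed.

(** The induction is on length because a second entry -1 removes two entries and negates the rest.
    Regularity then forces a third entry, equal to -1, so the negated rest starts with 1 again. *)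
Lemma regular_sign_cfrac e : signs e -> regular_cfrac (1 :: e) ->
  exists x, sign_cfrac (1 :: e) x.
Proof.
move sz: (size e) => n; elim/ltn_ind: n e sz => n IH [|a e] sz sgn reg.
  by exists 1; constructor.
have sgne : signs e by move=> x xe; apply: sgn; rewrite inE xe orbT.
have [ea|ea] := sgn a (mem_head _ _); subst a.
  have [||y ey] := IH (size e) _ e erefl sgne; first by rewrite -sz.
    case: e reg {sz sgn sgne IH} => [|b e]; first by split=> // -[].
    by case/regular_cfrac3.
  by exists (1 + y^-1); constructor.
case: e sz sgn sgne reg => [|b e] sz sgn sgne; first by move/regular_cfrac2.
case/regular_cfrac3=> _ /(_ isT) b_neg reg.
have eb : b = -1 by case: (sgne b (mem_head _ _)) b_neg => ->.
subst b; have sgne' : signs e by move=> x xe; apply: sgne; rewrite inE xe orbT.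
have [||y ey] := IH (size e) _ (map -%R e) (size_map _ _) (signs_opp _ sgne').
- by rewrite -sz.
(* The sequence [1 :: map -%R e] is the opposite of [-1 :: e], a tail of the given one. *)
- apply: (regular_cfrac_opp (-1 :: e)).
  case: e reg {sz sgn sgne sgne' IH} => [|c e]; first by split=> // -[].
  by case/regular_cfrac3.
exists (1 + y)^-1; have := SignCfracLt _ _ ey.
by rewrite /= (mapK opprK).
Qed.

(** Solving [1/(1 + y) = a/b] gives [y = (b - a)/a], and [1 + 1/y = a/b] gives [y = b/(a - b)].
    Either way numerator and denominator of [y] have a sum smaller than [a + b]. *)
Lemma sign_cfrac_ex a b : (0 < a)%N -> (0 < b)%N ->
  exists s, sign_cfrac s (a%:R / b%:R).
Proof.
move en: (a + b)%N => n; elim/ltn_ind: n a b en => n IH a b en a0 b0.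
have a0' : a%:R != 0 :> rat by rewrite pnatr_eq0 -lt0n.
have b0' : b%:R != 0 :> rat by rewrite pnatr_eq0 -lt0n.
have [ltab|ltba|eab] := ltngtP a b.
- have [||s sy] := IH (b - a + a)%N _ (b - a)%N a erefl _ a0; [lia|lia|].
  exists [:: 1, -1 & map -%R s]; have := SignCfracLt _ _ sy.
  suff -> : (1 + (b - a)%:R / a%:R)^-1 = a%:R / b%:R :> rat by [].
  by rewrite natrB ?(ltnW ltab) // mulrBl divff // addrC subrK invf_div.
- have [||s sy] := IH (b + (a - b))%N _ b (a - b)%N erefl b0; [lia|lia|].
  exists (1 :: s); have := SignCfracGt _ _ sy.
  suff -> : 1 + (b%:R / (a - b)%:R)^-1 = a%:R / b%:R :> rat by [].
  by rewrite natrB ?(ltnW ltba) // invf_div mulrBl divff // addrC subrK.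
- by exists [:: 1]; rewrite eab divff //; constructor.
Qed.

(** The second entry is 1 when the value exceeds 1 and -1 when it is below 1; the value 1 belongs to
    [[:: 1]], too short to be biregular. *)
Lemma sign_cfrac_biregular s x : sign_cfrac s x ->
  1 < x <-> biregular_cfrac s.
Proof.
move=> sx; have := sign_cfrac_regular _ _ sx.
case: sx => [|{}s y sy|{}s y sy] reg.
- by rewrite ltxx; split=> // -[].
- have [t est] := sign_cfrac_head _ _ sy.
  rewrite ltrDl invr_gt0 (sign_cfrac_gt0 _ _ sy).
  by split=> // _; rewrite est in reg *.
- split=> [|[_ _]] //.
  have y0 := sign_cfrac_gt0 _ _ sy.
  by rewrite invf_gt1 ?addr_gt0 // gtrDl ltNge (ltW y0).
Qed.

Theorem theorem2p6 (alpha beta : nat)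
    (alpha_gt0 : (0 < alpha)%N) (beta_gt0 : (0 < beta)%N)
    (cop : coprime alpha beta) :
  (exists! e : seq int,
     [/\ forall x : int, x \in e -> x = 1 \/ x = -1,
         regular_cfrac (1 :: e)
       & cfrac (1 :: e) = Some (alpha%:R / beta%:R)]) /\
  (forall e : seq int,
     (forall x : int, x \in e -> x = 1 \/ x = -1) ->
     regular_cfrac (1 :: e) ->
     cfrac (1 :: e) = Some (alpha%:R / beta%:R) ->
     ((beta < alpha)%N <-> biregular_cfrac (1 :: e))).
Proof.
(* The derivation given by regularity carries some value [y]; as [cfrac] computes it, [y] is the
   prescribed [x]. *)
have to_sign e x : signs e -> regular_cfrac (1 :: e) ->
    cfrac (1 :: e) = Some x -> sign_cfrac (1 :: e) x.
  move=> sgn /(regular_sign_cfrac _ sgn)[y ey].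
  by rewrite (sign_cfracE _ _ ey) => -[<-].
split=> [|e sgn reg val].
  have [s sx] := sign_cfrac_ex _ _ alpha_gt0 beta_gt0.
  have [e es] := sign_cfrac_head _ _ sx; subst s.
  exists e; split=> [|e' [sgn reg val]].
    split; [|exact: sign_cfrac_regular sx|exact: sign_cfracE].
    by move=> x xe; apply: (sign_cfrac_signs _ _ sx); rewrite inE xe orbT.
  by have [] := sign_cfrac_inj _ _ _ sx (to_sign _ _ sgn reg val).
have := sign_cfrac_biregular _ _ (to_sign _ _ sgn reg val).
by rewrite ltr_pdivlMr ?ltr0n // mul1r ltr_nat.
Qed.
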